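(* Let $F=(f_1,\dots,f_t)$ be a sequence of polynomials in the variables $x_1,\dots,x_n$ with coefficients in $\mathbb{Z}$ (or in $\mathbb{R}$), each written as a sum of monomials, and let $\overline{B}^*$ be the partially specified symmetric matrix constructed from $F$ as described in the context. Then the system of polynomial equations $f_1=0,\dots,f_t=0$ has a solution over $\mathbb{R}$ if and only if $\overline{B}^*$ can be completed to a rank-$3$ positive semidefinite matrix.
   Context: A completion of a partially specified matrix (entries are numbers or the symbol $*$, meaning unspecified) is a real symmetric matrix obtained by replacing each $*$ by a real number. Construction. For a monomial $p=\xi x_{i_1}\cdots x_{i_k}$ (with coefficient $\xi$) put $$\sigma(p)=\{\pm1,\pm\xi,\pm x_{i_1},\pm x_{i_1}x_{i_2},\dots,\pm x_{i_1}\cdots x_{i_k},p\}.$$ For a polynomial $f=p_1+\dots+p_s$ written as a sum of monomials put $$\sigma(f)=\sigma(p_1)\cup\dots\cup\sigma(p_s)\cup\{0,\pm p_1,\pm(p_1+p_2),\dots,\pm f\}\cup\{\pm x_1,\dots,\pm x_n\},$$ and $\sigma(F)=\sigma(f_1)\cup\dots\cup\sigma(f_t)$. Let $\mathcal{H}$ be the set of those vectors in $\sigma(F)^3$ (triples of polynomials) having at least one entry equal to $1$ or $-1$. Let $\overline{\mathcal{H}}$ be the multiset $\mathcal{H}\cup\{e_1,e_1,e_2,e_2,e_3,e_3\}$, where $e_1,e_2,e_3$ are the columns of the $3\times3$ identity matrix (so two additional copies of each $e_i$ are added and $|\overline{\mathcal{H}}|=|\mathcal{H}|+6$). Let $\overline{U}[x]$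 be the $3\times|\overline{\mathcal{H}}|$ polynomial matrix whose columns are the elements of $\overline{\mathcal{H}}$, and $\overline{W}[x]=\overline{U}[x]^{\top}\overline{U}[x]$. The symmetric matrix $\overline{B}^*$, with rows and columns indexed by $\overline{\mathcal{H}}$, has all diagonal entries equal to $*$, and for distinct indices $u,v\in\overline{\mathcal{H}}$ (distinct copies of the same vector are distinct indices): $\overline{B}^*(u,v)=0$ if $\overline{W}[x](u,v)\in F$; otherwise $\overline{B}^*(u,v)=\overline{W}[x](u,v)$ if $\overline{W}[x](u,v)$ is a constant (degree-0) polynomial; otherwise $\overline{B}^*(u,v)=*$. *)

(* Defs.v *)
From mathcomp Require Import all_boot all_order all_algebra.
From mathcomp Require Import reals.
From mathcomp Require Export mpoly.

Set Implicit Arguments.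
Unset Strict Implicit.
Unset Printing Implicit Defensive.

Import GRing.Theory Num.Theory.
Local Open Scope ring_scope.

(* The sets sigma(.) depend on how the polynomials are written, not only on
   their values: (xi, [:: i1; ...; ik]) is the expression xi x_i1 ... x_ik, with
   its factors in this order, and a list [:: p1; ...; ps] of such expressions
   is the sum p1 + ... + ps, with its terms in this order. *)
Definition mono (A : Type) (n : nat) : Type := (A * seq 'I_n)%type.
Definition mono_sum (A : Type) (n : nat) : Type := seq (mono A n).

Section Construction.
Variables (A : comNzRingType) (n : nat).
Implicit Types (p : mono A n) (f : mono_sum A n) (F : seq (mono_sum A n)).

Definition var_prod (s : seq 'I_n) : {mpoly A[n]} := \prod_(i <- s) 'X_i.
Definition mono_val p : {mpoly A[n]} := p.1%:MP * var_prod p.2.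
Definition sum_val f : {mpoly A[n]} := \sum_(p <- f) mono_val p.

Definition pm (s : seq {mpoly A[n]}) : seq {mpoly A[n]} :=
  s ++ [seq - q | q <- s].

Definition sigma_mono p : seq {mpoly A[n]} :=
  pm [:: 1, p.1%:MP & [seq var_prod (take k p.2) | k <- iota 1 (size p.2)]]
  ++ [:: mono_val p].

Definition sigma_sum f : seq {mpoly A[n]} :=
  flatten [seq sigma_mono p | p <- f]
  ++ 0 :: pm [seq sum_val (take k f) | k <- iota 1 (size f)]
  ++ pm [seq 'X_i | i <- enum 'I_n].

Definition sigma F : seq {mpoly A[n]} := flatten [seq sigma_sum f | f <- F].

Definition vec3 (a b c : {mpoly A[n]}) : 'cV[{mpoly A[n]}]_3 :=
  \col_i [:: a; b; c]`_i.

(* Duplicate-free, so that it enumerates a set; the order is immaterial. *)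
Definition calH F : seq 'cV[{mpoly A[n]}]_3 :=
  let S := sigma F in
  let triples := [seq vec3 ab.1 ab.2 c
                 | ab <- [seq (a, b) | a <- S, b <- S], c <- S] in
  undup [seq v : 'cV[{mpoly A[n]}]_3 <- triples
        | [exists i : 'I_3, (v i 0 == 1) || (v i 0 == -1)]].

(* The list positions of calHbar F are the indices of the multiset, so
   distinct copies of the same vector are distinct indices. *)
Definition calHbar F : seq 'cV[{mpoly A[n]}]_3 :=
  calH F ++ flatten [seq [:: col i 1%:M; col i 1%:M] | i <- enum 'I_3].

Definition Ubar F : 'M[{mpoly A[n]}]_(3, size (calHbar F)) :=
  \matrix_(i, j) (calHbar F)`_j i 0.

Definition Wbar F : 'M[{mpoly A[n]}]_(size (calHbar F)) :=
  (Ubar F)^T *m Ubar F.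

(* None stands for the symbol *. The test msize q <= 1 says that q is a
   constant polynomial, possibly 0, and q@_0 is then its value. *)
Definition Bbar F : 'M[option A]_(size (calHbar F)) :=
  \matrix_(u, v)
    if u == v then None
    else let q := Wbar F u v in
      if q \in [seq sum_val f | f <- F] then Some 0
      else if (msize q <= 1)%N then Some q@_0%MM
      else None.

End Construction.

Section Completion.
Variables (R : realType) (m : nat).

Definition is_completion (B : 'M[option R]_m) (M : 'M[R]_m) : Prop :=
  M^T = M /\ forall i j c, B i j = Some c -> M i j = c.

Definition is_psd (M : 'M[R]_m) : Prop :=
  M^T = M /\ forall x : 'cV[R]_m, 0 <= (x^T *m M *m x) 0 0.

Definition has_rank3_psd_completion (B : 'M[option R]_m) : Prop :=
  exists M : 'M[R]_m, [/\ is_completion B M, is_psd M & \rank M = 3%N].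

End Completion.

(* Main.v *)
Require Import Defs.
From HB Require Import structures.
From mathcomp Require Import all_boot all_order all_algebra.
From mathcomp Require Import reals ring lra.

Set Implicit Arguments.
Unset Strict Implicit.
Unset Printing Implicit Defensive.

Import Order.TTheory GRing.Theory Num.Theory.
Local Open Scope ring_scope.

(** A solution [x] gives the completion [U(x)^T U(x)], the Gram matrix of the
    evaluated columns: its prescribed entries are right because members of [F]
    vanish at [x], and its rank is 3 because the columns contain the standard
    basis ([eval_solution_completion]).

    For the converse, a completion [M] is read as a Gram matrix of vectors in
    dimension 3, and one shows that the vector attached to a triple of
    polynomials is the triple of their values at a single point. The difficulty
    is to recover coordinates from inner products, when inner products
    belonging to [F] have been replaced by 0.

    First, constants in [F] have to be excluded, since they falsify products
    such as [e_i . e_i = 1]. If 1 is in [F], take a constant [c] of [F] with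
    [2c] outside [F]. The four vectors (1,1,0), (1,-1,0), (1,0,1), (1,0,-1) have
    products 0 or 1, hence prescribed entries 0, while each of them has product
    [2c] with some other vector, so that its diagonal entry in [M] is not 0:
    then [M] has rank at least 4 ([one_poly_rank]). So 1 is not in [F], and the
    three copies of each [e_i] have pairwise product 1. As copies of distinct
    basis vectors are orthogonal and the rank is 3, the copies of [e_i] are
    proportional to each other; three proportional vectors with pairwise
    products 1 are, two by two, equal unit vectors ([frame_diag]). This
    orthonormal frame gives coordinates in which [M] is a sum of three products
    ([gram_coord]). If a constant [c] is in [F], the coordinates of (1,c,c) and
    (1,c,0) are both (1,0,0), whereas their prescribed product is [1 + c^2]
    or 0; so [c = 0] ([constant_poly_eq0]).

    From there on all constant inner products are correct. Applied to well
    chosen orthogonal vectors, this shows that the coordinate attached to an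
    entry [q] depends only on [q] ([coord_first], [coord_second],
    [coord_third], [coord_second_N1]); call it the value of [q]. Orthogonality
    of (1, p, p+q) with (q, 1, -1) and of (1, p, pq) with (0, q, -1) makes
    the value additive and multiplicative ([value_add], [value_mul]). The set
    [sigma F] contains all the intermediate results of the computation of each
    polynomial of [F], so the value is the evaluation at the point formed by
    the values of the variables ([eval_partial_sum]). Finally, the product of
    (1, f, 0) with [e_2] is [f], a member of [F], so the value of [f] is 0
    ([value_poly]). *)

(** * Matrices with an orthogonal family *)

Section OrthogonalFamily.
Variables (R : fieldType) (m k : nat) (M : 'M[R]_m) (f : 'I_k -> 'I_m).
Variable d : 'I_k -> R.
Hypothesis d_neq0 : forall i, d i != 0.
Hypothesis Mf : forall i j, M (f i) (f j) = d i *+ (i == j).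

Lemma orthogonal_row_free : row_free (rowsub f M).
Proof.
apply/row_freeP; exists (\matrix_(a, j) ((a == f j)%:R / d j)).
apply/matrixP=> i j; rewrite !mxE (bigD1 (f j)) //= !mxE eqxx big1 => [|a ne_a].
  rewrite addr0 Mf; case: eqP => [->|_]; last by rewrite mul0r.
  by rewrite mulr1n mulrA mulr1 divff.
by rewrite !mxE (negbTE ne_a) mul0r mulr0.
Qed.

Lemma orthogonal_rank_ge : (k <= \rank M)%N.
Proof.
by rewrite -[X in (X <= _)%N](eqP orthogonal_row_free) mxrankS ?rowsub_sub.
Qed.

(** When the orthogonal family is as large as the rank, its rows span all the
    rows, so the form is determined by its values against the family; this
    avoids factoring [M] as a Gram matrix. *)
Lemma orthogonal_expansion u v :
  \rank M = k -> M u v = \sum_j M u (f j) / d j * M (f j) v.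
Proof.
move=> rkM; have /submxP[w Mu] : (row u M <= rowsub f M)%MS.
  apply: submx_trans (row_sub u M) _.
  by rewrite -(geq_leqif (mxrank_leqif_sup (rowsub_sub f M)))
             (eqP orthogonal_row_free) rkM.
have Muw a : M u a = \sum_j w 0 j * M (f j) a.
  have := congr1 (fun r : 'rV_m => r 0 a) Mu; rewrite !mxE => ->.
  by apply: eq_bigr => j _; rewrite !mxE.
rewrite Muw; apply: eq_bigr => j _; congr (_ * _).
rewrite Muw (bigD1 j) //= Mf eqxx big1 => [|i ne_i].
  by rewrite addr0 mulr1n mulfK.
by rewrite Mf (negbTE ne_i) mulr0.
Qed.

End OrthogonalFamily.

(** Otherwise the form would be affine and not constant in [t] on the vectors
    [t e_i + e_j], hence negative somewhere. *)
Lemma psd_diag_eq0 (R : realType) m (M : 'M[R]_m) i j :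
  is_psd M -> M i i = 0 -> M i j = 0.
Proof.
case=> MT psdM Mii; apply/eqP/negPn/negP => Mij.
(* This t makes the value of the form at t e_i + e_j equal to -1. *)
pose t := - (M j j + 1) / (2 * M i j).
have := psdM (t *: delta_mx i 0 + delta_mx j 0).
have E a b : (delta_mx a 0)^T *m M *m delta_mx b 0 = (M a b)%:M :> 'M_1.
  by apply/matrixP=> p q; rewrite !ord1 trmx_delta -rowE -colE !mxE eqxx.
have Mji : M j i = M i j by rewrite -[in LHS]MT mxE.
rewrite [_^T]linearD /= [X in (X + _) *m M]linearZ /= !mulmxDl !mulmxDr.
rewrite -!scalemxAl -!scalemxAr !E !mxE /= !mulr1n Mii Mji.
have -> : t * (t * 0) + t * M i j + (t * M i j + M j j) = -1.
  by rewrite /t; field.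
lra.
Qed.

(** * The polynomial vectors and the positions that they occupy *)

Local Notation o0 := (@Ordinal 3 0 isT).
Local Notation o1 := (@Ordinal 3 1 isT).
Local Notation o2 := (@Ordinal 3 2 isT).

Lemma sum3E (V : nmodType) (G : 'I_3 -> V) :
  \sum_(i < 3) G i = G o0 + G o1 + G o2.
Proof.
rewrite !big_ord_recl big_ord0 addr0 addrA.
by congr (G _ + G _ + G _); apply: val_inj.
Qed.

Lemma nth_flatten_twice (T I : Type) (x0 : T) (i0 : I) (g : I -> T) s k b :
  (k < size s)%N ->
  nth x0 (flatten [seq [:: g i; g i] | i <- s]) (k.*2 + nat_of_bool b)
    = g (nth i0 s k).
Proof.
elim: s k => [|i s IHs] [|k] //= lt_k; first by case: (b).
by rewrite -IHs.
Qed.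

Definition polys (A : comNzRingType) n (F : seq (mono_sum A n)) :=
  [seq sum_val f | f <- F].

Section Construction.
Variables (A : comNzRingType) (n : nat) (F : seq (mono_sum A n)).
Local Notation S := (sigma F).
Implicit Types (u w : 'cV[{mpoly A[n]}]_3) (f : mono_sum A n).

Lemma sigma_sumS f q : f \in F -> q \in sigma_sum f -> q \in S.
Proof. by move=> Ff fq; apply/flatten_mapP; exists f. Qed.

Lemma sigma_monoS f p q : f \in F -> p \in f -> q \in sigma_mono p -> q \in S.
Proof.
move=> Ff fp pq; apply: sigma_sumS Ff _; rewrite mem_cat.
by apply/orP; left; apply/flatten_mapP; exists p.
Qed.

Lemma sigma0 f : f \in F -> 0 \in S.
Proof. by move=> Ff; apply: sigma_sumS Ff _; rewrite !mem_cat inE eqxx orbT. Qed.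

Lemma sigma1 f p : f \in F -> p \in f -> 1 \in S.
Proof. by move=> Ff fp; apply: sigma_monoS Ff fp _; rewrite inE eqxx. Qed.

Lemma sigmaN1 f p : f \in F -> p \in f -> -1 \in S.
Proof.
move=> Ff fp; apply: sigma_monoS Ff fp _.
by rewrite !mem_cat map_f ?orbT // inE eqxx.
Qed.

Lemma sigma_coef f p : f \in F -> p \in f -> p.1%:MP \in S.
Proof. by move=> Ff fp; apply: sigma_monoS Ff fp _; rewrite !inE eqxx orbT. Qed.

Lemma sigma_mono_val f p : f \in F -> p \in f -> mono_val p \in S.
Proof.
by move=> Ff fp; apply: sigma_monoS Ff fp _; rewrite mem_cat mem_head orbT.
Qed.

Lemma sigma_var_prod f p s t :
  f \in F -> p \in f -> p.2 = s ++ t -> var_prod A s \in S.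
Proof.
move=> Ff fp def_p; case: s => [|i s] in def_p *.
  by rewrite /var_prod big_nil; apply: sigma1 Ff fp.
apply: sigma_monoS Ff fp _; rewrite !mem_cat !inE; do 2!(apply/orP; left).
apply/orP; right; apply/orP; right; apply/mapP; exists (size (i :: s)).
  by rewrite mem_iota def_p size_cat add1n ltnS (leq_addr (size t)).
by rewrite def_p take_size_cat.
Qed.

Lemma sigma_partial_sum f s t : f \in F -> f = s ++ t -> sum_val s \in S.
Proof.
move=> Ff def_f; case: s => [|p s] in def_f *.
  by rewrite /sum_val big_nil; apply: sigma0 Ff.
apply: sigma_sumS Ff _; rewrite !(mem_cat, inE).
apply/orP; right; apply/orP; right; apply/orP; left; apply/orP; left.
apply/mapP; exists (size (p :: s)).
  by rewrite mem_iota def_f size_cat add1n ltnS (leq_addr (size t)).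
by rewrite def_f take_size_cat.
Qed.

Lemma sigma_var i f : f \in F -> 'X_i \in S.
Proof.
move=> Ff; apply: sigma_sumS Ff _; rewrite !(mem_cat, inE).
by rewrite (map_f (fun i => 'X_i)) ?mem_enum ?orbT.
Qed.

Lemma sigma_poly q : q \in polys F -> q \in S.
Proof. by case/mapP=> f Ff ->; apply: (sigma_partial_sum Ff (esym (cats0 f))). Qed.

Lemma sigma_oppr_poly q : q \in polys F -> - q \in S.
Proof.
case/mapP=> f Ff ->; case Df: f => [|p s].
  by rewrite /sum_val big_nil oppr0; apply: sigma0 Ff.
apply: sigma_sumS Ff _; rewrite !(mem_cat, inE).
apply/orP; right; apply/orP; right; apply/orP; left; apply/orP; right.
apply/map_f/mapP; exists (size f); last by rewrite take_size Df.
by rewrite mem_iota Df add1n ltnS leqnn.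
Qed.

Definition dot u w : {mpoly A[n]} := \sum_k u k 0 * w k 0.

Lemma dot_vec3 a b c a' b' c' :
  dot (vec3 a b c) (vec3 a' b' c') = a * a' + b * b' + c * c'.
Proof. by rewrite /dot sum3E !mxE. Qed.

Lemma dot_delta u i : dot u (col i 1%:M) = u i 0.
Proof.
rewrite /dot (bigD1 i) //= big1 => [|k ne_k].
  by rewrite !mxE eqxx mulr1 addr0.
by rewrite !mxE (negbTE ne_k) mulr0.
Qed.

Lemma vec3_eqE (a b c a' b' c' : {mpoly A[n]}) :
  (vec3 a b c == vec3 a' b' c') = [&& a == a', b == b' & c == c'].
Proof.
apply/eqP/and3P => [/colP E | [/eqP-> /eqP-> /eqP->] //].
by split; apply/eqP; [have := E o0 | have := E o1 | have := E o2]; rewrite !mxE.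
Qed.

Lemma col_delta (i : 'I_3) :
  col i 1%:M = vec3 (i == o0)%:R (i == o1)%:R (i == o2)%:R
    :> 'cV[{mpoly A[n]}]_3.
Proof.
apply/colP=> k; rewrite !mxE eq_sym.
by case: k => -[|[|[|k]]] lt_k //=; congr (_ == _)%:R; apply: val_inj.
Qed.

Lemma mem_calH a b c : a \in S -> b \in S -> c \in S ->
    [|| (a == 1) || (a == -1), (b == 1) || (b == -1) | (c == 1) || (c == -1)] ->
  vec3 a b c \in calH F.
Proof.
move=> Sa Sb Sc unit_abc.
rewrite mem_undup mem_filter; apply/andP; split.
  case/or3P: unit_abc => u1; apply/existsP.
  - by exists o0; rewrite !mxE.
  - by exists o1; rewrite !mxE.
  - by exists o2; rewrite !mxE.
apply/allpairsP; exists ((a, b), c); split=> //=.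
by apply/allpairsP; exists (a, b).
Qed.

Lemma calH_unit u : u \in calH F -> exists i, (u i 0 == 1) || (u i 0 == -1).
Proof. by rewrite mem_undup mem_filter => /andP[/existsP]. Qed.

Local Notation position := 'I_(size (calHbar F)).
Definition column (k : position) := (calHbar F)`_k.

Lemma size_calHbar : size (calHbar F) = (size (calH F) + 6)%N.
Proof.
rewrite size_cat size_flatten /shape -map_comp; congr (_ + _)%N.
rewrite (eq_map (g := fun=> 2)) // sumnE big_map big_enum.
by rewrite sum_nat_const card_ord.
Qed.

Lemma copy_subproof (b : bool) (i : 'I_3) :
  (size (calH F) + (i.*2 + b) < size (calHbar F))%N.
Proof.
by rewrite size_calHbar ltn_add2l; case: i => -[|[|[|i]]] //= _; case: b.
Qed.

(** The two copies of a basis vector that are appended to [calH F]. *)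
Definition copy b i : position := Ordinal (copy_subproof b i).

Lemma column_copy b i : column (copy b i) = col i 1%:M.
Proof.
rewrite /column /calHbar nth_cat /= ltnNge leq_addr /= addKn.
by rewrite (nth_flatten_twice _ i) ?nth_ord_enum // size_enum_ord.
Qed.

Lemma copy_inj b i b' i' : copy b i = copy b' i' -> b = b' /\ i = i'.
Proof.
case=> /addnI E.
have Eb : b = b' by have := congr1 odd E; rewrite !oddD !odd_double !oddb.
split=> //; apply: val_inj; have := congr1 half E.
by rewrite Eb !(addnC _.*2) !half_bit_double.
Qed.

(** Meant for members of [calH F], where it is the position preceding the
    appended copies; any position would do as the default value. *)
Definition pos u : position := insubd (copy false o0) (index u (calHbar F)).

Lemma val_pos u : u \in calH F -> pos u = index u (calH F) :> nat.
Proof.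
move=> Hu; rewrite val_insubd /calHbar index_mem mem_cat Hu /=.
by rewrite index_cat Hu.
Qed.

Lemma column_pos u : u \in calH F -> column (pos u) = u.
Proof.
move=> Hu; rewrite /column val_pos // /calHbar nth_cat index_mem Hu.
by rewrite nth_index.
Qed.

Lemma pos_neq u w : u \in calH F -> w \in calH F -> u != w -> pos u != pos w.
Proof.
by move=> Hu Hw; apply: contraNneq => E; rewrite -(column_pos Hu) E column_pos.
Qed.

Lemma pos_neq_copy u b i : u \in calH F -> pos u != copy b i.
Proof.
move=> Hu; rewrite -val_eqE /= val_pos // neq_ltn.
by rewrite ltn_addr // index_mem.
Qed.

Lemma WbarE i j : Wbar F i j = dot (column i) (column j).
Proof. by rewrite mxE; apply: eq_bigr => k _; rewrite !mxE. Qed.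

End Construction.

(** * From a solution to a completion *)

Section Equivalence.
(* This covers both the inclusion of the integers and the identity of R. *)
Variables (R : realType) (A : comNzRingType) (phi : {rmorphism A -> R}).
Hypothesis phi_inj : injective phi.
Variables (n : nat) (F : seq (mono_sum A n)).
Implicit Types (u w : 'cV[{mpoly A[n]}]_3) (x : 'I_n -> R).
Implicit Types a b c q : {mpoly A[n]}.
Local Notation S := (sigma F).
Local Notation B := (map_mx (omap phi) (Bbar F)).

Definition eval x q : R := (map_mpoly phi q).@[x].

Fact eval_is_zmod_morphism x : zmod_morphism (eval x).
Proof. by move=> p q; rewrite /eval !rmorphB. Qed.
Fact eval_is_monoid_morphism x : monoid_morphism (eval x).
Proof. by split=> [|p q]; rewrite /eval ?rmorph1 // !rmorphM. Qed.
HB.instance Definition _ x :=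
  GRing.isZmodMorphism.Build {mpoly A[n]} R (eval x) (eval_is_zmod_morphism x).
HB.instance Definition _ x :=
  GRing.isMonoidMorphism.Build {mpoly A[n]} R (eval x)
    (eval_is_monoid_morphism x).

Lemma evalC x (c : A) : eval x c%:MP = phi c.
Proof. by rewrite /eval map_mpolyC mevalC. Qed.

Lemma evalX x i : eval x 'X_i = x i.
Proof. by rewrite /eval map_mpolyX mevalXU. Qed.

Lemma eval_solution_completion x :
  (forall q, q \in polys F -> eval x q = 0) -> has_rank3_psd_completion B.
Proof.
move=> solx; pose U := map_mx (eval x) (Ubar F).
have ME i j : (U^T *m U) i j = eval x (Wbar F i j).
  by rewrite /U map_trmx -map_mxM mxE.
have MT : (U^T *m U)^T = U^T *m U by rewrite trmx_mul trmxK.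
exists (U^T *m U); split.
- split=> // i j c; rewrite ME mxE [Bbar F i j]mxE.
  case: (i == j) => //=; case: ifP => [/solx Fq [<-] | _].
    by rewrite Fq rmorph0.
  by case: ifP => //= /msize1_polyC def_q [<-]; rewrite {1}def_q evalC.
- split=> // y; rewrite mulmxA -mulmxA -trmx_mul.
  by rewrite mxE sumr_ge0 // => k _; rewrite mxE -expr2 sqr_ge0.
apply/eqP; rewrite eqn_leq (leq_trans (mxrankM_maxr _ _) (rank_leq_row _)) /=.
apply: (@orthogonal_rank_ge _ _ _ _ (copy F false) (fun=> 1)) => [_|i j].
  exact: oner_neq0.
rewrite ME WbarE !column_copy dot_delta !mxE.
by rewrite eq_sym (rmorph_nat (eval x)).
Qed.

(** * Constants and orthonormal frame of a completion *)

Section Completion.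
Variable M : 'M[R]_(size (calHbar F)).
Hypotheses (complM : is_completion B M) (psdM : is_psd M).

Lemma completion_sym i j : M i j = M j i.
Proof. by case: psdM => MT _; rewrite -[in LHS]MT mxE. Qed.

(** The entry that the partial matrix imposes where the inner product is the
    constant [c]. *)
Definition prescribed (c : A) : R := if c%:MP \in polys F then 0 else phi c.

Lemma prescribed0 : prescribed 0 = 0.
Proof. by rewrite /prescribed; case: ifP => // _; rewrite rmorph0. Qed.

Lemma completion_poly0 (i j : 'I_(size (calHbar F))) :
  i != j -> dot (column i) (column j) \in polys F -> M i j = 0.
Proof.
move=> ne_ij Fij; case: complM => _ /(_ i j 0); apply.
by rewrite mxE [Bbar F i j]mxE (negbTE ne_ij) WbarE /= Fij /= rmorph0.
Qed.

Lemma completion_const (i j : 'I_(size (calHbar F))) (c : A) :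
  i != j -> dot (column i) (column j) = c%:MP -> M i j = prescribed c.
Proof.
move=> ne_ij Wc; rewrite /prescribed; case: ifP => Fc.
  by apply: completion_poly0; rewrite ?Wc.
case: complM => _; apply.
rewrite mxE [Bbar F i j]mxE (negbTE ne_ij) WbarE Wc /= Fc.
by rewrite msizeC leq_b1 mpolyCK.
Qed.

Hypotheses (S0 : 0 \in S) (S1 : 1 \in S) (SN1 : -1 \in S).

Lemma completion_calH u w (c : A) : u \in calH F -> w \in calH F -> u != w ->
  dot u w = c%:MP -> M (pos F u) (pos F w) = prescribed c.
Proof.
move=> Hu Hw ne_uw uw_c; apply: completion_const; first exact: pos_neq.
by rewrite !column_pos.
Qed.

(** The finite list [polys F] cannot contain all the powers of 2; [c] is the
    last one before the first that is missing. *)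
Lemma double_notin_polys : 1 \in polys F -> exists c : A,
  [/\ c%:MP \in polys F, (c *+ 2)%:MP \notin polys F & c != 0].
Proof.
move=> F1; pose v k : {mpoly A[n]} := ((2 ^ k)%:R : A)%:MP.
have v_inj : injective v.
  move=> i j /eqP; rewrite mpolyC_eq => /eqP /(congr1 phi).
  by rewrite !rmorph_nat => /eqP; rewrite eqr_nat eqn_exp2l // => /eqP.
have exF : exists k, v k \notin polys F.
  have [/allP allF | /allPn[k _ Fk]] :=
    boolP (all (fun k => v k \in polys F) (iota 0 (size F).+1)); last by exists k.
  have : (size [seq v k | k <- iota 0 (size F).+1] <= size (polys F))%N.
    apply: uniq_leq_size; first by rewrite map_inj_uniq ?iota_uniq.
    by move=> _ /mapP[k /allF Fk ->].
  by rewrite !size_map size_iota ltnn.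
case: (ex_minnP exF) => -[|k] Fk min_k.
  by rewrite /v expn0 mpolyC1 F1 in Fk.
exists (2 ^ k)%:R; split.
- by apply: contraT => /min_k; rewrite ltnn.
- by rewrite -mulrnA -expnSr.
- by rewrite -(inj_eq phi_inj) rmorph0 rmorph_nat pnatr_eq0 expn_eq0.
Qed.

Lemma completion_diag_neq0 i j : M i j != 0 -> M i i != 0.
Proof. by apply: contra_neq => /(psd_diag_eq0 j psdM). Qed.

Lemma mpoly_neq1N1 : (1 == -1 :> {mpoly A[n]}) = false.
Proof.
apply/eqP => /(congr1 (eval (fun=> 0))); rewrite rmorphN rmorph1; lra.
Qed.

(** All the products of distinct members of [us] are 0 or 1, so the completion
    makes them orthogonal, and none of them is isotropic, because (1, s, 0) has
    product [2c] with (c, sc, 1), and (1, 0, s) with (c, 1, sc), for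
    [s = 1, -1]. *)
Lemma one_poly_rank : 1 \in polys F -> (4 <= \rank M)%N.
Proof.
move=> F1; have [c [Fc F2c c0]] := double_notin_polys F1.
have Sc := sigma_poly Fc; have SNc := sigma_oppr_poly Fc.
have presc1 : prescribed 1 = 0 by rewrite /prescribed mpolyC1 F1.
have presc2 : prescribed (c *+ 2) != 0.
  rewrite /prescribed (negbTE F2c) rmorphMn mulrn_eq0 /=.
  by rewrite -(rmorph0 phi) (inj_eq phi_inj).
pose us := [:: vec3 1 1 0; vec3 1 (-1) 0; vec3 1 0 1; vec3 1 0 (-1)]
  : seq 'cV[{mpoly A[n]}]_3.
have us_calH u : u \in us -> u \in calH F.
  by rewrite !inE => /or4P[] /eqP->; apply: mem_calH; rewrite ?eqxx.
have n10 : (1 == 0 :> {mpoly A[n]}) = false by exact: oner_eq0.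
have nN10 : (-1 == 0 :> {mpoly A[n]}) = false by rewrite oppr_eq0.
have uniq_us : uniq us.
  by rewrite /= !inE !vec3_eqE ![0 == _]eq_sym n10 nN10 mpoly_neq1N1 !andbF.
have diag u : u \in us -> M (pos F u) (pos F u) != 0.
  move=> us_u; have Hw w : w \in calH F -> u != w ->
      dot u w = (c *+ 2)%:MP -> M (pos F u) (pos F u) != 0.
    move=> Hw ne_uw uw_c; apply: (@completion_diag_neq0 _ (pos F w)).
    by rewrite (completion_calH (us_calH u us_u) Hw ne_uw uw_c).
  move: us_u Hw; rewrite !inE => /or4P[] /eqP-> Hw;
    [ apply: (Hw (vec3 c%:MP c%:MP 1)) | apply: (Hw (vec3 c%:MP (- c%:MP) 1))
    | apply: (Hw (vec3 c%:MP 1 c%:MP)) | apply: (Hw (vec3 c%:MP 1 (- c%:MP)))];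
    first [ by apply: mem_calH; rewrite ?eqxx /= ?orbT
          | by rewrite vec3_eqE ![0 == _]eq_sym n10 /= ?andbF
          | by rewrite dot_vec3 mpolyCMn; ring ].
have orth u w : u \in us -> w \in us -> u != w -> M (pos F u) (pos F w) = 0.
  move=> us_u us_w ne_uw.
  have [] : dot u w = 0%:MP \/ dot u w = 1%:MP.
    move: us_u us_w ne_uw; rewrite !inE.
    by move=> /or4P[]/eqP-> /or4P[]/eqP->; rewrite ?eqxx // => _;
      rewrite dot_vec3 mpolyC1 mpolyC0; (left; ring) || (right; ring).
  - by move/completion_calH->; rewrite ?us_calH // prescribed0.
  - by move/completion_calH->; rewrite ?us_calH.
apply: (@orthogonal_rank_ge _ _ _ M (fun i : 'I_4 => pos F us`_i)
  (fun i => M (pos F us`_i) (pos F us`_i))) => [i|i j].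
  by apply/diag/mem_nth.
case: eqP => [->//|/eqP ne_ij]; rewrite mulr0n.
by apply: orth; rewrite ?mem_nth // nth_uniq.
Qed.

Hypothesis rkM : \rank M = 3.

Lemma one_notin_polys : 1 \notin polys F.
Proof. by apply/negP => /one_poly_rank; rewrite rkM. Qed.

Lemma prescribed1 : prescribed 1 = 1.
Proof. by rewrite /prescribed mpolyC1 (negbTE one_notin_polys) rmorph1. Qed.

Lemma delta_calH i : col i 1%:M \in calH F.
Proof.
rewrite col_delta.
by case: i => -[|[|[|i]]] //= lt_i; apply: mem_calH; rewrite ?eqxx ?orbT.
Qed.

Definition frame i := pos F (col i 1%:M).

Lemma frame_neq_copy i (b : bool) j : frame i != copy F b j.
Proof. exact/pos_neq_copy/delta_calH. Qed.

Lemma frame_copy (b : bool) i : M (frame i) (copy F b i) = 1.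
Proof.
rewrite (@completion_const _ _ 1) ?frame_neq_copy ?prescribed1 //.
by rewrite column_pos ?delta_calH // column_copy dot_delta !mxE eqxx.
Qed.

Lemma frame_orthogonal i j : i != j -> M (frame i) (frame j) = 0.
Proof.
move=> ne_ij; have W0 : dot (col i 1%:M) (col j 1%:M) = (0 : A)%:MP_[n].
  by rewrite dot_delta !mxE eq_sym (negbTE ne_ij).
rewrite (completion_calH _ _ _ W0) ?prescribed0 ?delta_calH //.
apply/eqP => /colP/(_ i); rewrite !mxE eqxx (negbTE ne_ij) => /eqP.
by rewrite oner_eq0.
Qed.

Let frameM : forall i j,
  M (frame i) (frame j) = M (frame i) (frame i) *+ (i == j).
Proof. by move=> i j; case: eqP => [->//|/eqP/frame_orthogonal]. Qed.

Let frame_neq0 i : M (frame i) (frame i) != 0.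
Proof.
by apply: (@completion_diag_neq0 _ (copy F false i)); rewrite frame_copy oner_neq0.
Qed.

(** The vectors at [frame i], [copy false i] and [copy true i] are proportional
    and have pairwise products 1; expanding the product of the two copies along
    the frame gives [1 = 1 * d^-1 * 1], with [d] the squared length of the frame
    vector. *)
Lemma frame_diag i : M (frame i) (frame i) = 1.
Proof.
have : M (copy F false i) (copy F true i) = 1.
  rewrite (@completion_const _ _ 1) ?prescribed1 //.
    by apply/eqP => /copy_inj[].
  by rewrite !column_copy dot_delta !mxE eqxx.
rewrite (orthogonal_expansion frame_neq0 frameM _ _ rkM) (bigD1 i) //=.
rewrite big1 => [|j ne_ji].
  rewrite completion_sym !frame_copy mulr1 addr0 mul1r.
  by move/(canRL invrK) ->; rewrite invr1.
rewrite completion_sym (@completion_const _ _ 0).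
- by rewrite prescribed0 !mul0r.
- exact: frame_neq_copy.
rewrite column_pos ?delta_calH // column_copy dot_delta !mxE.
by rewrite eq_sym (negbTE ne_ji).
Qed.

Definition coord u i := M (pos F u) (frame i).

Lemma gram_coord u w :
  M (pos F u) (pos F w) =
    coord u o0 * coord w o0 + coord u o1 * coord w o1 + coord u o2 * coord w o2.
Proof.
rewrite (orthogonal_expansion frame_neq0 frameM _ _ rkM).
rewrite -[RHS](sum3E (fun j => coord u j * coord w j)).
by apply: eq_bigr => j _; rewrite frame_diag divr1 (completion_sym (frame j)).
Qed.

Lemma coord_const u i (c : A) :
  u \in calH F -> u i 0 = c%:MP -> coord u i = prescribed c.
Proof.
move=> Hu ui; rewrite /coord /frame.
case: (eqVneq u (col i 1%:M)) => [Du | ne_u].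
  rewrite Du frame_diag; move: ui; rewrite Du !mxE eqxx -mpolyC1.
  by move/eqP; rewrite mpolyC_eq => /eqP<-; rewrite prescribed1.
by apply: completion_calH; rewrite ?delta_calH ?dot_delta.
Qed.

(** Both (1, c, c) and (1, c, 0) have coordinates (1, 0, 0), since [c] is in [F],
    so their product in the completion is 1; but it is prescribed to be
    [1 + c ^+ 2], or 0 if that constant is in [F] as well. *)
Lemma constant_poly_eq0 (c : A) : c%:MP \in polys F -> c = 0.
Proof.
move=> Fc; apply/eqP/contraT => c0; have Sc := sigma_poly Fc.
pose u : 'cV[{mpoly A[n]}]_3 := vec3 1 c%:MP c%:MP.
pose w : 'cV[{mpoly A[n]}]_3 := vec3 1 c%:MP 0.
have Hu : u \in calH F by apply: mem_calH; rewrite ?eqxx.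
have Hw : w \in calH F by apply: mem_calH; rewrite ?eqxx.
have ne_uw : u != w by rewrite vec3_eqE mpolyC_eq0 (negbTE c0) !andbF.
have pc : prescribed c = 0 by rewrite /prescribed Fc.
have uw : dot u w = (1 + c ^+ 2)%:MP.
  by rewrite dot_vec3 mpolyCD mpolyC1 expr2 mpolyCM; ring.
have := completion_calH Hu Hw ne_uw uw; rewrite gram_coord.
rewrite !(@coord_const _ o0 1) // ?mxE ?mpolyC1 //.
rewrite !(@coord_const _ o1 c) // ?mxE //.
rewrite (@coord_const u o2 c) // ?mxE // prescribed1 pc /prescribed.
case: ifP => _; first lra.
have := c0; rewrite -(inj_eq phi_inj) rmorph0 rmorphD rmorph1 rmorphXn /=.
by rewrite -sqrf_eq0 => /eqP nc2 E; case: nc2; lra.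
Qed.

Lemma prescribedE (c : A) : prescribed c = phi c.
Proof.
by rewrite /prescribed; case: ifP => // /constant_poly_eq0 ->; rewrite rmorph0.
Qed.

(** A vector with an entry 1 or -1 is not isotropic, as evaluation at the origin
    shows; so orthogonality alone ensures that the two positions differ, and
    that the entry between them is not an unspecified diagonal one. *)
Lemma dot0_neq u w : u \in calH F -> dot u w = 0 -> u != w.
Proof.
move=> /calH_unit[i ui]; apply: contra_eq_neq => <-.
apply/eqP => /(congr1 (eval (fun=> 0))); rewrite rmorph0 rmorph_sum /=.
under eq_bigr do rewrite rmorphM -expr2.
move/eqP; rewrite psumr_eq0 => [|k _]; last exact: sqr_ge0.
move/allP/(_ i (mem_index_enum i)); rewrite sqrf_eq0.
by case/orP: ui => /eqP->; rewrite ?rmorphN rmorph1 ?oppr_eq0 oner_eq0.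
Qed.

Lemma coord_dot0 u w : u \in calH F -> w \in calH F -> dot u w = 0 ->
  coord u o0 * coord w o0 + coord u o1 * coord w o1 + coord u o2 * coord w o2 = 0.
Proof.
move=> Hu Hw uw0; rewrite -gram_coord -prescribed0.
by apply: completion_calH (dot0_neq Hu uw0) _; rewrite // mpolyC0.
Qed.

Lemma coord0 u i : u \in calH F -> u i 0 = 0 -> coord u i = 0.
Proof. by move=> Hu ui; rewrite (@coord_const _ _ 0) ?prescribed0 // mpolyC0. Qed.

Lemma coord1 u i : u \in calH F -> u i 0 = 1 -> coord u i = 1.
Proof. by move=> Hu ui; rewrite (@coord_const _ _ 1) ?prescribed1 // mpolyC1. Qed.

Lemma coordN1 u i : u \in calH F -> u i 0 = -1 -> coord u i = -1.
Proof.
by move=> Hu ui; rewrite (@coord_const _ _ (-1)) ?prescribedE ?rmorphN1.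
Qed.

(** * The value of a polynomial *)

Let unitrE := (mul1r, mulr1, mul0r, mulr0, mulrN1, mulN1r, addr0, add0r).

(** The coordinate attached to the entry [q], read off from one particular vector
    containing [q]; the following lemmas transfer it to the other places where
    [q] can occur, through pairs of orthogonal vectors. *)
Definition value q := coord (vec3 q 0 (-1)) o0.

(** By orthogonality of (1, z, q) and (q, 0, -1). *)
Lemma coord_third q z : q \in S -> z \in S -> coord (vec3 1 z q) o2 = value q.
Proof.
move=> Sq Sz; rewrite /value; set u := vec3 1 z q; set w := vec3 q 0 (-1).
have Hu : u \in calH F by apply: mem_calH; rewrite ?eqxx.
have Hw : w \in calH F by apply: mem_calH; rewrite ?eqxx ?orbT.
have := coord_dot0 Hu Hw; rewrite dot_vec3 (@coord1 u o0) ?mxE //.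
rewrite (@coord0 w o1) ?(@coordN1 w o2) ?mxE // !unitrE => E.
by apply/esym/subr0_eq/E; ring.
Qed.

(** By orthogonality of (1, 0, q) and (q, z, -1). *)
Lemma coord_first q z : q \in S -> z \in S -> coord (vec3 q z (-1)) o0 = value q.
Proof.
move=> Sq Sz; rewrite -(coord_third Sq S0).
set u := vec3 1 0 q; set w := vec3 q z (-1).
have Hu : u \in calH F by apply: mem_calH; rewrite ?eqxx.
have Hw : w \in calH F by apply: mem_calH; rewrite ?eqxx ?orbT.
have := coord_dot0 Hu Hw; rewrite dot_vec3 (@coord1 u o0) ?mxE //.
rewrite (@coord0 u o1) ?(@coordN1 w o2) ?mxE // !unitrE => E.
by apply/subr0_eq/E; ring.
Qed.

(** The vector (1, q, q), orthogonal to (0, 1, -1), passes from the third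
    coordinate to the second, and (q, -1, 0), orthogonal to every (1, q, z),
    makes the second coordinate independent of [z]. *)
Lemma coord_second q z : q \in S -> z \in S -> coord (vec3 1 q z) o1 = value q.
Proof.
move=> Sq Sz.
set u := vec3 1 q q; set w := @vec3 A n 0 1 (-1); set v := vec3 q (-1) 0.
set t := vec3 1 q z.
have Hu : u \in calH F by apply: mem_calH; rewrite ?eqxx.
have Hw : w \in calH F by apply: mem_calH; rewrite ?eqxx ?orbT.
have Hv : v \in calH F by apply: mem_calH; rewrite ?eqxx ?orbT.
have Ht : t \in calH F by apply: mem_calH; rewrite ?eqxx.
have := coord_dot0 Hu Hw; rewrite dot_vec3 (coord_third Sq Sq) => uw.
have := coord_dot0 Hu Hv; rewrite dot_vec3 => uv.
have := coord_dot0 Ht Hv; rewrite dot_vec3 => tv.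
have := uw ltac:(ring); have := uv ltac:(ring); have := tv ltac:(ring).
rewrite (@coord0 w o0) ?(@coord1 w o1) ?(@coordN1 w o2) ?mxE //.
rewrite (@coordN1 v o1) ?(@coord0 v o2) ?mxE //.
rewrite (@coord1 u o0) ?(@coord1 t o0) ?mxE // !unitrE.
by move=> /subr0_eq <- /subr0_eq -> /subr0_eq.
Qed.

(** The vector (q, q, -1), orthogonal to (1, -1, 0), passes from the first
    coordinate to the second, and (0, 1, q), orthogonal to every (z, q, -1),
    makes the second coordinate independent of [z]. *)
Lemma coord_second_N1 q z :
  q \in S -> z \in S -> coord (vec3 z q (-1)) o1 = value q.
Proof.
move=> Sq Sz.
set u := vec3 q q (-1); set w := @vec3 A n 1 (-1) 0; set v := vec3 0 1 q.
set t := vec3 z q (-1).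
have Hu : u \in calH F by apply: mem_calH; rewrite ?eqxx ?orbT.
have Hw : w \in calH F by apply: mem_calH; rewrite ?eqxx.
have Hv : v \in calH F by apply: mem_calH; rewrite ?eqxx ?orbT.
have Ht : t \in calH F by apply: mem_calH; rewrite ?eqxx ?orbT.
have := coord_dot0 Hu Hw; rewrite dot_vec3 (coord_first Sq Sq) => uw.
have := coord_dot0 Hu Hv; rewrite dot_vec3 => uv.
have := coord_dot0 Ht Hv; rewrite dot_vec3 => tv.
have := uw ltac:(ring); have := uv ltac:(ring); have := tv ltac:(ring).
rewrite (@coord1 w o0) ?(@coordN1 w o1) ?(@coord0 w o2) ?mxE //.
rewrite (@coord0 v o0) ?(@coord1 v o1) ?mxE //.
rewrite (@coordN1 u o2) ?(@coordN1 t o2) ?mxE // !unitrE.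
by move=> /subr0_eq -> /subr0_eq <- /subr0_eq.
Qed.

Lemma value_const (c : A) : c%:MP \in S -> value c%:MP = phi c.
Proof.
move=> Sc; rewrite /value (@coord_const _ _ c) ?prescribedE ?mxE //.
by apply: mem_calH; rewrite ?eqxx ?orbT.
Qed.

(** By orthogonality of (1, p, p + q) and (q, 1, -1). *)
Lemma value_add p q : p \in S -> q \in S -> p + q \in S ->
  value (p + q) = value p + value q.
Proof.
move=> Sp Sq Spq; set u := vec3 1 p (p + q); set w := vec3 q 1 (-1).
have Hu : u \in calH F by apply: mem_calH; rewrite ?eqxx.
have Hw : w \in calH F by apply: mem_calH; rewrite ?eqxx ?orbT.
have := coord_dot0 Hu Hw; rewrite dot_vec3 (@coord1 u o0) ?mxE //.
rewrite (@coord1 w o1) ?(@coordN1 w o2) ?mxE //.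
rewrite coord_second // coord_third // coord_first // !unitrE => E.
by rewrite [RHS]addrC; apply/esym/subr0_eq/E; ring.
Qed.

(** By orthogonality of (1, p, p * q) and (0, q, -1). *)
Lemma value_mul p q : p \in S -> q \in S -> p * q \in S ->
  value (p * q) = value p * value q.
Proof.
move=> Sp Sq Spq; set u := vec3 1 p (p * q); set w := vec3 0 q (-1).
have Hu : u \in calH F by apply: mem_calH; rewrite ?eqxx.
have Hw : w \in calH F by apply: mem_calH; rewrite ?eqxx ?orbT.
have := coord_dot0 Hu Hw; rewrite dot_vec3 (@coord1 u o0) ?mxE //.
rewrite (@coord0 w o0) ?(@coordN1 w o2) ?mxE //.
rewrite coord_second // coord_third // coord_second_N1 // !unitrE => E.
by apply/esym/subr0_eq/E; ring.
Qed.

(** The product of (1, q, 0) with the second basis vector is [q] itself, which is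
    in [F], so that the corresponding entry is prescribed to be 0. *)
Lemma value_poly q : q \in polys F -> value q = 0.
Proof.
move=> Fq; have Sq := sigma_poly Fq.
have Hu : vec3 1 q 0 \in calH F by apply: mem_calH; rewrite ?eqxx.
rewrite -(coord_second Sq S0); apply: completion_poly0.
  apply: pos_neq (delta_calH _) _; first exact: Hu.
  by rewrite col_delta vec3_eqE oner_eq0.
by rewrite !column_pos ?delta_calH // dot_delta mxE.
Qed.

Definition point i := value 'X_i.

(** The sublists of factors that [sigma] provides are the prefixes, so the
    induction removes the last factor; likewise for sums below. *)
Lemma eval_var_prod f p s t : f \in F -> p \in f -> p.2 = s ++ t ->
  eval point (var_prod A s) = value (var_prod A s).
Proof.
move=> Ff fp; elim/last_ind: s t => [|s i IHs] t def_p.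
  by rewrite /var_prod big_nil rmorph1 -mpolyC1 value_const ?rmorph1.
have Srcons := sigma_var_prod Ff fp def_p.
rewrite cat_rcons in def_p; have Ss := sigma_var_prod Ff fp def_p.
have E : var_prod A (rcons s i) = var_prod A s * 'X_i.
  by rewrite /var_prod big_rcons /= mulrC.
rewrite E in Srcons *; rewrite value_mul ?(sigma_var _ Ff) //.
by rewrite rmorphM /= evalX (IHs _ def_p).
Qed.

Lemma eval_mono_val f p : f \in F -> p \in f ->
  eval point (mono_val p) = value (mono_val p).
Proof.
move=> Ff fp; have def_p := esym (cats0 p.2).
have [Sc Sv] := (sigma_coef Ff fp, sigma_var_prod Ff fp def_p).
rewrite rmorphM /= evalC (eval_var_prod Ff fp def_p) -value_const //.
by rewrite -value_mul ?(sigma_mono_val Ff).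
Qed.

Lemma eval_partial_sum f s t : f \in F -> f = s ++ t ->
  eval point (sum_val s) = value (sum_val s).
Proof.
move=> Ff; elim/last_ind: s t => [|s p IHs] t def_f.
  by rewrite /sum_val big_nil rmorph0 -mpolyC0 value_const ?rmorph0.
have fp : p \in f by rewrite def_f mem_cat mem_rcons mem_head.
have Srcons := sigma_partial_sum Ff def_f.
rewrite cat_rcons in def_f; have Ss := sigma_partial_sum Ff def_f.
have E : sum_val (rcons s p) = sum_val s + mono_val p.
  by rewrite /sum_val big_rcons /= addrC.
rewrite E in Srcons *; rewrite value_add ?(sigma_mono_val Ff) //.
by rewrite rmorphD /= (IHs _ def_f) (eval_mono_val Ff).
Qed.

Lemma point_solution q : q \in polys F -> eval point q = 0.
Proof.
move=> Fq; rewrite -[RHS](value_poly Fq); case/mapP: Fq => f Ff ->.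
exact: eval_partial_sum Ff (esym (cats0 f)).
Qed.

End Completion.

(** The main argument needs 0, 1 and -1 in [sigma F], which may fail only if all
    the sums of [F] are empty; then every point is a solution. *)
Lemma completion_solution :
  has_rank3_psd_completion B ->
  exists x, forall q, q \in polys F -> eval x q = 0.
Proof.
case=> M [complM psdM rkM].
have [/hasP[f Ff] | /hasPn F_nil] := boolP (has (fun f => f != [::]) F); last first.
  exists (fun=> 0) => _ /mapP[f /F_nil/negPn/eqP-> ->].
  by rewrite /sum_val big_nil rmorph0.
case Df: f => [//|p s] _; have fp : p \in f by rewrite Df mem_head.
exists (point M) => q.
apply: (point_solution complM psdM (sigma0 Ff) (sigma1 Ff fp) (sigmaN1 Ff fp) rkM).
Qed.

Lemma solution_completion_iff :
  (exists x, forall q, q \in polys F -> eval x q = 0) <->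
  has_rank3_psd_completion B.
Proof.
split; last exact: completion_solution.
by case=> x; exact: eval_solution_completion.
Qed.

End Equivalence.

(** * The equivalence *)

Theorem theorem4p5 (R : realType) (n : nat) :
  (forall F : seq (mono_sum int n),
     (exists x : 'I_n -> R,
        forall q, q \in [seq sum_val f | f <- F] ->
          (map_mpoly intr q).@[x] = 0)
     <-> has_rank3_psd_completion
           (map_mx (omap (intr : int -> R)) (Bbar F)))
  /\
  (forall F : seq (mono_sum R n),
     (exists x : 'I_n -> R,
        forall q, q \in [seq sum_val f | f <- F] -> q.@[x] = 0)
     <-> has_rank3_psd_completion (Bbar F)).
Proof.
split=> F.
  exact: (solution_completion_iff (phi := intr) (@intr_inj R) F).
have idB : map_mx (omap idfun) (Bbar F) = Bbar F.
  by apply/matrixP=> i j; rewrite mxE; case: (Bbar F i j).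
have := solution_completion_iff (phi := idfun) (@inj_id R) F.
rewrite idB => <-.
have idE x q : @eval R R idfun n x q = q.@[x].
  by congr _.@[_]; apply/mpolyP=> k; rewrite mcoeff_map_mpoly.
by split=> -[x solx]; exists x => q /solx; rewrite idE.
Qed.
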